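(* Let $\mathcal{D}\subseteq\mathbb{R}^n$ be bounded and closed, and let $f=(f_1,\dots,f_m)^T:\mathcal{D}\to\mathbb{R}^m$ satisfy the following conditions. (i) $f$ is differentiable on $\mathcal{D}$ with continuous derivative $f'$. (ii) $f$ satisfies the local tangential cone condition in $\mathcal{D}$: there are constants $\xi_1,\dots,\xi_m\ge 0$ with $\xi:=\max_{1\le i\le m}\xi_i\le\frac12$ such that $|f_i(y)-f_i(z)-f_i'(y)(y-z)|\le \xi_i|f_i(y)-f_i(z)|$ for all $y,z\in\mathcal{D}$ and all $1\le i\le m$. (iii) There is $x^\dagger\in\mathcal{D}$ with $f(x^\dagger)=0$. (iv) $\mathcal{N}(f'(x^\dagger))\subseteq\mathcal{N}(f'(x))$ for all $x\in\mathcal{D}$. Let $x_0\in\mathcal{D}$, and let $x^\dagger$ be the solution of $f(x)=0$ in $\mathcal{D}$ of minimal distance to $x_0$, which satisfies $x^\dagger-x_0\in\mathcal{R}(f'(x^\dagger)^T)$. Let $q\ge2$ be an integer, let $\omega\in[0,1)$ and $\rho\in(0,1]$, and let $\alpha=\max_{1\le i\le m}\sup_{x\in\mathcal{D}}\|f_i'(x)\|^2$. Put $$a_1=1+3\omega+2\omega^2-(1-2\xi+3\omega-4\omega\xi)\frac{m^{1-q}\rho\,\sigma_{\min}^2(f'(x^\dagger))}{\alpha(1+\xi)^2},\qquad a_2=\omega+2\omega^2,$$ and assume $a_1+a_2<1$. Let $\{x_k\}\subset\mathcal{D}$ be the sequence generated from $x_0$ by the MRWNK-m method (defined in the context) with parameters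 $q$, $\omega$ and $\rho$. Then for every $k\ge1$ for which $x_{k+1}$ is generated, $$\|x_{k+1}-x^\dagger\|^2\le p_2^k(1+b_2)\|x_0-x^\dagger\|^2,$$ where $p_2=\frac{a_1+\sqrt{a_1^2+4a_2}}{2}$, $b_2=p_2-a_1$, and $a_1+a_2\le p_2<1$.
   Context: Notation: $\|\cdot\|$ is the Euclidean norm; $[m]=\{1,\dots,m\}$; $f'(x)\in\mathbb{R}^{m\times n}$ is the Jacobian matrix of $f$ at $x$ and $f_i'(x)$ is its $i$th row; $\mathcal{N}(A)$ is the null space and $\mathcal{R}(A)$ the column space of a matrix $A$; $\sigma_{\min}(A)$ is the smallest nonzero singular value of $A$. For $\tau\subseteq[m]$, $f_\tau$ and $f'_\tau$ denote the restrictions of $f$ and of the rows of $f'$ to the indices in $\tau$. MRWNK-m method (maximum residual residual-based weighted nonlinear Kaczmarz method with momentum): set $x_1=x_0$. For $k=1,2,\dots$, as long as $f(x_k)\ne0$ (the method stops otherwise), let $$\tau_k=\Big\{i\in[m]: |f_i(x_k)|^2\ge\rho\max_{j\in[m]}|f_j(x_k)|^2\Big\},$$ let $\eta_k\in\mathbb{R}^{|\tau_k|}$ be the vector with entries, for $i\in\tau_k$, $\eta_k^{(i)}=f_i(x_k)^{q-1}$ if $q$ is even and $\eta_k^{(i)}=|f_i(x_k)^{q-2}|\,f_i(x_k)$ if $q$ is odd, and set $$x_{k+1}=x_k-\frac{\eta_k^Tf_{\tau_k}(x_k)}{\|f'_{\tau_k}(x_k)^T\eta_k\|^2}f'_{\tau_k}(x_k)^T\eta_k+\omega(x_k-x_{k-1}).$$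 *)

(* Defs.v *)
From HB Require Import structures.
From mathcomp Require Import all_boot all_order all_algebra.
From mathcomp Require Import all_classical all_reals all_analysis.

Set Implicit Arguments.
Unset Strict Implicit.
Unset Printing Implicit Defensive.

Import Order.TTheory GRing.Theory Num.Theory.
Import numFieldNormedType.Exports.
Local Open Scope classical_set_scope.
Local Open Scope ring_scope.

(* The norm `|v| that the library puts on matrices is the sup norm.  It is used
   below only through the topology and boundedness, which it shares with the
   Euclidean norm. *)
Definition enorm (R : realType) (m n : nat) (v : 'M[R]_(m, n)) : R :=
  Num.sqrt (\sum_i \sum_j v i j ^+ 2).

Definition null_space (R : realType) (m n : nat) (A : 'M[R]_(m, n)) :
  set 'cV[R]_n := [set v | A *m v = 0].

Definition col_space (R : realType) (m n : nat) (A : 'M[R]_(m, n)) :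
  set 'cV[R]_m := range (fun w : 'cV[R]_n => A *m w).

Definition nz_singular_values (R : realType) (m n : nat) (A : 'M[R]_(m, n)) :
  set R := [set s | 0 < s /\ eigenvalue (A^T *m A) (s ^+ 2)].

(* The set is finite, so for A != 0 the infimum is a minimum; sigma_min 0 = 0. *)
Definition sigma_min (R : realType) (m n : nat) (A : 'M[R]_(m, n)) : R :=
  inf (nz_singular_values A).

(* f is only meant to be defined on D, so its derivative at x in D is taken
   along y in D; no condition is put on f outside D.  At boundary points this
   need not determine J x, hence J is carried along with f. *)
Definition derivative_on (R : realType) (m n : nat) (D : set 'cV[R]_n)
    (f : 'cV[R]_n -> 'cV[R]_m) (J : 'cV[R]_n -> 'M[R]_(m, n)) : Prop :=
  forall x, D x -> let F := within D (nbhs x) in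
    (fun y => f y - f x - J x *m (y - x)) =o_F (fun y => y - x).

Definition tangential_cone (R : realType) (m n : nat) (D : set 'cV[R]_n)
    (f : 'cV[R]_n -> 'cV[R]_m) (J : 'cV[R]_n -> 'M[R]_(m, n))
    (xi_ : 'I_m -> R) : Prop :=
  forall y z, D y -> D z -> forall i,
    `|f y i 0 - f z i 0 - (row i (J y) *m (y - z)) 0 0|
      <= xi_ i * `|f y i 0 - f z i 0|.

Section MRWNKm.
Variables (R : realType) (m n : nat).
Variables (f : 'cV[R]_n -> 'cV[R]_m) (J : 'cV[R]_n -> 'M[R]_(m, n)).
Variables (q : nat) (omega rho : R).

Definition tau (x : 'cV[R]_n) : {set 'I_m} :=
  [set i | rho * \big[Num.max/0]_j `|f x j 0| ^+ 2 <= `|f x i 0| ^+ 2]%SET.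

Definition weight (a : R) : R :=
  if odd q then `|a ^+ q.-2| * a else a ^+ q.-1.

Definition f_tau (x : 'cV[R]_n) : 'cV[R]_#|tau x| := rowsub enum_val (f x).

Definition J_tau (x : 'cV[R]_n) : 'M[R]_(#|tau x|, n) := rowsub enum_val (J x).

Definition eta (x : 'cV[R]_n) : 'cV[R]_#|tau x| := map_mx weight (f_tau x).

(* u is the previous iterate, x the current one. *)
Definition MRWNKm_step (u x : 'cV[R]_n) : 'cV[R]_n :=
  let g := (J_tau x)^T *m eta x in
  x - (((eta x)^T *m f_tau x) 0 0 / enorm g ^+ 2) *: g + omega *: (x - u).

(* x_k is generated when the method has not stopped at any x_j, 1 <= j < k.
   The values of x beyond the stopping index are unconstrained. *)
Definition generated (x : nat -> 'cV[R]_n) (k : nat) : Prop :=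
  forall j, (1 <= j < k)%N -> f (x j) <> 0.

Definition MRWNKm_sequence (x0 : 'cV[R]_n) (x : nat -> 'cV[R]_n) : Prop :=
  [/\ x 0%N = x0, x 1%N = x0 &
    forall k, (1 <= k)%N -> generated x k.+1 ->
      x k.+1 = MRWNKm_step (x k.-1) (x k)].

End MRWNKm.

(* Main.v *)
Require Import Defs.
From HB Require Import structures.
From mathcomp Require Import all_boot all_order all_algebra.
From mathcomp Require Import all_classical all_reals all_analysis.
From mathcomp Require Import ring lra.

Set Implicit Arguments.
Unset Strict Implicit.
Unset Printing Implicit Defensive.

Import Order.TTheory GRing.Theory Num.Theory.
Import numFieldNormedType.Exports.
Local Open Scope classical_set_scope.
Local Open Scope ring_scope.

(* Write e_k = x_k - x^dag and let g = f'_tau^T eta be the update direction at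
   x_k, S = eta^T f_tau(x_k), t = S / |g|^2.  The cone condition gives
   <g, e_k> >= (1 - xi) S, which turns the momentum step into
     |e_(k+1)|^2 <= (1 + 3 w + 2 w^2) |e_k|^2 + (w + 2 w^2) |e_(k-1)|^2
                    - (1 - 2 xi + 3 w - 4 w xi) S^2 / |g|^2.
   With W = sum_i |eta_i| and M = max_j |f_j(x_k)|^2, every index of tau has
   |f_i| >= sqrt (rho M), so S^2 >= rho M W^2, while |g|^2 <= alpha W^2.  All
   errors e_k stay in R(f'(x^dag)^T), on which
     sigma_min^2 |e|^2 <= |f'(x^dag) e|^2 <= (1 + xi)^2 |f(x_k)|^2
                       <= (1 + xi)^2 m M.
   Thus S^2 / |g|^2 dominates |e_k|^2 (even with the factor 1/m in place of
   the smaller m^(1-q)) and |e_(k+1)|^2 <= a1 |e_k|^2 + a2 |e_(k-1)|^2.  As p2 is the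
   larger root of p^2 = a1 p + a2, the quantity |e_(k+1)|^2 + b2 |e_k|^2
   contracts by the factor p2. *)

(** * Euclidean inner product on column vectors *)

Definition dot (R : realType) (n : nat) (u v : 'cV[R]_n) : R :=
  \sum_i u i 0 * v i 0.

Section DotProduct.
Variables (R : realType) (m n : nat).
Implicit Types (u v w : 'cV[R]_n) (a : R).

Lemma enorm_sqr u : enorm u ^+ 2 = dot u u.
Proof.
rewrite sqr_sqrtr; last by do 2 (apply: sumr_ge0 => ? _); exact: sqr_ge0.
by apply: eq_bigr => i _; rewrite big_ord1 expr2.
Qed.

Lemma enorm_row_sqr (v : 'rV[R]_n) : enorm v ^+ 2 = dot v^T v^T.
Proof.
rewrite sqr_sqrtr; last by do 2 (apply: sumr_ge0 => ? _); exact: sqr_ge0.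
by rewrite big_ord1; apply: eq_bigr => i _; rewrite mxE expr2.
Qed.

Lemma dotC u v : dot u v = dot v u.
Proof. by apply: eq_bigr => i _; rewrite mulrC. Qed.

Lemma dotDl u v w : dot (u + v) w = dot u w + dot v w.
Proof. by rewrite -big_split; apply: eq_bigr => i _; rewrite mxE mulrDl. Qed.

Lemma dotZl a u v : dot (a *: u) v = a * dot u v.
Proof. by rewrite mulr_sumr; apply: eq_bigr => i _; rewrite mxE mulrA. Qed.

Lemma dotNl u v : dot (- u) v = - dot u v.
Proof. by rewrite -scaleN1r dotZl mulN1r. Qed.

Lemma dotDr u v w : dot u (v + w) = dot u v + dot u w.
Proof. by rewrite ![dot u _]dotC dotDl. Qed.

Lemma dotZr a u v : dot u (a *: v) = a * dot u v.
Proof. by rewrite ![dot u _]dotC dotZl. Qed.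

Lemma dotNr u v : dot u (- v) = - dot u v.
Proof. by rewrite ![dot u _]dotC dotNl. Qed.

Definition dotE := (dotDl, dotDr, dotNl, dotNr, dotZl, dotZr).

Lemma dot_ge0 u : 0 <= dot u u.
Proof. by apply: sumr_ge0 => i _; rewrite -expr2 sqr_ge0. Qed.

Lemma dot_eq0 u : (dot u u == 0) = (u == 0).
Proof.
apply/eqP/eqP => [|->]; last by rewrite /dot big1 // => i _; rewrite mxE mul0r.
move/eqP; rewrite psumr_eq0 => [/allP u0|i _]; last by rewrite -expr2 sqr_ge0.
apply/colP => i; rewrite mxE; apply/eqP.
by have := u0 i (mem_index_enum _); rewrite mulf_eq0 orbb.
Qed.

Lemma dot_trmx_mul (A : 'M[R]_(m, n)) (u : 'cV[R]_m) v :
  dot (A^T *m u) v = dot u (A *m v).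
Proof.
rewrite /dot; under eq_bigr do rewrite mxE mulr_suml.
rewrite exchange_big; apply: eq_bigr => i _ /=.
by rewrite mxE mulr_sumr; apply: eq_bigr => j _; rewrite mxE; ring.
Qed.

(** Expanding |u + v|^2 >= 0 and |u - v|^2 >= 0 is enough, so no square roots enter. *)
Lemma normr_dot_le a u v : dot u u <= a -> dot v v <= a -> `|dot u v| <= a.
Proof.
move=> ua va.
have p := dot_ge0 (u + v); have q := dot_ge0 (u - v).
move: p q; rewrite !dotE (dotC v u) ler_norml => p q.
by apply/andP; split; lra.
Qed.

(** |A^T u|^2 is the sum of u_i u_k <A_i, A_k> over pairs of rows of [A], and every Gram entry is at
    most [a] in absolute value. *)
Lemma dot_trmx_mul_le (A : 'M[R]_(m, n)) a (u : 'cV[R]_m) :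
  (forall i, dot (row i A)^T (row i A)^T <= a) ->
  dot (A^T *m u) (A^T *m u) <= a * (\sum_i `|u i 0|) ^+ 2.
Proof.
move=> rowa; rewrite dot_trmx_mul expr2 mulrCA mulr_suml.
apply: ler_sum => i _; rewrite mulmxA mxE.
rewrite (le_trans (ler_norm _)) // normrM.
apply: ler_wpM2l; first exact: normr_ge0.
rewrite mulr_sumr (le_trans (ler_norm_sum _ _ _)) //.
apply: ler_sum => k _; rewrite normrM ler_wpM2r ?normr_ge0 //.
have -> : (A *m A^T) i k = dot (row i A)^T (row k A)^T.
  by rewrite mxE; apply: eq_bigr => j _; rewrite !mxE.
exact: normr_dot_le.
Qed.

End DotProduct.

(** * Compactness of the domain and boundedness of the Jacobian rows *)

Section Compactness.
Variable R : realType.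

Lemma normr_coord_le (m n : nat) (A : 'M[R]_(m, n)) i j : `|A i j| <= `|A|.
Proof.
rewrite [leRHS]/Num.norm /= mx_normrE.
exact: (le_bigmax _ (fun ij : 'I_m * 'I_n => `|A ij.1 ij.2|) (i, j)).
Qed.

Lemma normr_le_coord (m n : nat) (A : 'M[R]_(m, n)) (M : R) :
  0 <= M -> (forall i j, `|A i j| <= M) -> `|A| <= M.
Proof.
by move=> M0 AM; rewrite [leLHS]/Num.norm /= mx_normrE; apply: bigmax_le => // -[].
Qed.

Lemma trmx_continuous (m n : nat) : continuous (@trmx R m n).
Proof.
move=> A s /= /(nbhs_ballP A^T) [e e0 es].
apply/nbhs_ballP; exists e => //= B [_ AB]; apply: es; split => // i j.
by rewrite !mxE; exact: AB.
Qed.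

(** Heine-Borel for row vectors, carried over to columns by transposition. *)
Lemma cV_bounded_closed_compact (n : nat) (D : set 'cV[R]_n) :
  bounded_set D -> closed D -> compact D.
Proof.
move=> Db Dc.
have -> : D = trmx @` (trmx @^-1` D : set 'rV[R]_n).
  rewrite eqEsubset; split => [v Dv|_ [v Dv <-]//].
  by exists v^T; rewrite /= ?trmxK.
apply: continuous_compact.
  exact/continuous_subspaceT/trmx_continuous.
apply: bounded_closed_compact; last first.
  by apply: closed_comp => // v _; exact: trmx_continuous.
(* [|M|] replaces [M] so that every [N] above it is nonnegative, as [normr_le_coord] requires. *)
have [M [_ DM]] := Db; exists `|M|; split => [|N MN v /= Dv]; first exact: num_real.
apply: normr_le_coord => [|i j]; first exact: le_trans (ltW MN).
rewrite -[v]trmxK mxE (le_trans (normr_coord_le _ _ _)) //.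
by apply: DM => //; apply: le_lt_trans (ler_norm M) MN.
Qed.

(** This makes the suprema in [alpha] genuine upper bounds, since [sup] of an unbounded set is only
    a default value. *)
Lemma row_norm_has_ubound (m n : nat) (D : set 'cV[R]_n)
    (J : 'cV[R]_n -> 'M[R]_(m, n)) i :
  compact D -> {within D, continuous J} ->
  has_ubound [set enorm (row i (J z)) ^+ 2 | z in D].
Proof.
move=> Dc Jc.
have [M0 [_ M0J]] : bounded_set (J @` D).
  exact/compact_bounded/continuous_compact.
pose M := M0 + 1; have MJ A : (J @` D) A -> `|A| <= M by apply: M0J; rewrite ltrDl.
exists (n%:R * M ^+ 2) => _ [z Dz <-].
rewrite enorm_row_sqr /dot -[n in n%:R]card_ord -sum1_card natr_sum mulr_suml.
apply: ler_sum => j _; rewrite mul1r !mxE -expr2 -real_normK ?num_real //.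
rewrite lerXn2r ?nnegrE ?normr_ge0 //.
- by apply: le_trans (MJ (J z) _) => //; exists z.
- by apply: le_trans (normr_coord_le _ _ _) (MJ (J z) _); exists z.
Qed.

End Compactness.

(** * Row spaces, null spaces and continuity of linear and quadratic maps *)

Section RowSpace.
Variables (R : realType) (m n : nat) (A : 'M[R]_(m, n)).

Lemma col_spaceD (u v : 'cV[R]_m) :
  col_space A u -> col_space A v -> col_space A (u + v).
Proof. by move=> [a _ <-] [b _ <-]; exists (a + b) => //; rewrite mulmxDr. Qed.

Lemma col_spaceZ a (u : 'cV[R]_m) : col_space A u -> col_space A (a *: u).
Proof. by move=> [w _ <-]; exists (a *: w) => //; rewrite scalemxAr. Qed.

Lemma col_spaceN (u : 'cV[R]_m) : col_space A u -> col_space A (- u).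
Proof. by rewrite -scaleN1r; exact: col_spaceZ. Qed.

(** Describing the row space by linear equations makes its closedness visible. *)
Lemma col_space_trmxE (v : 'cV[R]_n) :
  col_space A^T v <-> (cokermx A)^T *m v = 0.
Proof.
split=> [[w _ <-]|].
  by rewrite mulmxA -trmx_mul mulmx_coker trmx0 mul0mx.
move=> /(congr1 trmx); rewrite trmx_mul trmxK trmx0 => /eqP.
rewrite -submxE => /submxP[w vE]; exists w^T => //.
by rewrite -trmx_mul -vE trmxK.
Qed.

(** The columns of [cokermx A] lie in the null space of [A], so [B] kills them. The resulting
    factorization of [B] through [A] keeps the update directions in R(A^T). *)
Lemma null_space_submx (p : nat) (B : 'M[R]_(p, n)) :
  null_space A `<=` null_space B -> (B <= A)%MS.
Proof.
move=> AB; rewrite submxE; apply/eqP/matrixP => i j.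
have /AB /matrixP/(_ i 0) : null_space A (col j (cokermx A)).
  by rewrite /null_space /= colE mulmxA mulmx_coker mul0mx.
by rewrite colE mulmxA -colE !mxE.
Qed.

Lemma sum_continuous (T : topologicalType) (I : finType) (F : I -> T -> R) :
  (forall i, continuous (F i)) -> continuous (fun x => \sum_i F i x).
Proof.
move=> Fc; apply: continuous_big => [|i _]; last exact: Fc.
by move=> x; apply: cvgD; [exact: cvg_fst|exact: cvg_snd].
Qed.

Lemma mulmx_continuous (p : nat) (B : 'M[R]_(p, n)) i :
  continuous (fun v : 'cV[R]_n => (B *m v) i 0).
Proof.
have -> : (fun v : 'cV[R]_n => (B *m v) i 0)
    = (fun v => \sum_j B i j * v j 0).
  by apply/funext => v; rewrite mxE.
have coordM j : continuous (fun v : 'cV[R]_n => B i j * v j 0).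
  move=> v; apply: (@continuousM R 'cV[R]_n (cst (B i j)) (fun w => w j 0)).
    exact: cst_continuous.
  exact: coord_continuous.
exact: sum_continuous.
Qed.

Lemma dot_continuous (p : nat) (B : 'M[R]_(p, n)) :
  continuous (fun v : 'cV[R]_n => dot (B *m v) (B *m v)).
Proof.
have coordM j : continuous (fun v : 'cV[R]_n => (B *m v) j 0 * (B *m v) j 0).
  by move=> v; apply: (@continuousM R 'cV[R]_n); exact: mulmx_continuous.
exact: sum_continuous.
Qed.

End RowSpace.

(** * Variational bound for the smallest nonzero singular value *)

Section SigmaMin.
Variables (R : realType) (m n : nat) (A : 'M[R]_(m, n)).

Let sphere : set 'cV[R]_n := [set v | col_space A^T v /\ dot v v = 1].

Lemma row_space_sphere_compact : compact sphere.
Proof.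
apply: cV_bounded_closed_compact.
  exists 1; split => [|N N1 v [_ v1] /=]; first exact: num_real.
  apply: normr_le_coord => [|i j]; first by apply: ltW; apply: lt_trans N1.
  apply: le_trans (ltW N1); rewrite [j]ord1.
  rewrite -(ler_pXn2r (ltn0Sn 1)) ?nnegrE ?normr_ge0 // expr1n -v1.
  rewrite real_normK ?num_real // /dot (bigD1 i) //= -expr2 lerDl.
  by apply: sumr_ge0 => k _; rewrite -expr2 sqr_ge0.
have -> : sphere = (fun v => dot (1%:M *m v) (1%:M *m v)) @^-1` [set 1]
    `&` \bigcap_(i in [set: 'I_n])
          (fun v => ((cokermx A)^T *m v) i 0) @^-1` [set 0].
  rewrite eqEsubset; split => v /=.
    move=> [/col_space_trmxE v0 v1]; rewrite mul1mx; split => // i _.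
    by rewrite /= v0 mxE.
  rewrite mul1mx => -[v1 v0]; split => //; apply/col_space_trmxE/colP => i.
  by rewrite [LHS]v0 // mxE.
apply: closedI.
  apply: closed_comp => [v _|]; first exact: dot_continuous.
  exact: closed_eq.
apply: closed_bigI => i _; apply: closed_comp => [v _|]; last exact: closed_eq.
exact: mulmx_continuous.
Qed.

(** Testing at t = -b / (c + 1) gives a negative value unless b = 0; the added 1 covers c = 0. *)
Lemma quadratic_ge0_linear_eq0 (b c : R) :
  (forall t, 0 <= 2 * t * b + t ^+ 2 * c) -> b = 0.
Proof.
move=> Q; have c0 : 0 <= c by have := Q 1; have := Q (-1); lra.
have : 0 <= (2 * (- b / (c + 1)) * b + (- b / (c + 1)) ^+ 2 * c) * (c + 1) ^+ 2.
  by rewrite mulr_ge0 ?sqr_ge0.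
have -> : (2 * (- b / (c + 1)) * b + (- b / (c + 1)) ^+ 2 * c) * (c + 1) ^+ 2
    = - (b ^+ 2 * (c + 2)) by field; lra.
have b2 := sqr_ge0 b; rewrite oppr_ge0 pmulr_lle0; last lra.
by move=> b2le; apply/eqP; rewrite -sqrf_eq0 eq_le b2le b2.
Qed.

(* A minimizer v of |A v|^2 on the unit sphere of R(A^T) is critical, hence an
   eigenvector of A^T A; its eigenvalue is not 0 as N(A) meets R(A^T) in 0. *)
Lemma sigma_min_bound (v : 'cV[R]_n) :
  col_space A^T v ->
  0 <= sigma_min A /\ sigma_min A ^+ 2 * dot v v <= dot (A *m v) (A *m v).
Proof.
move=> vA.
have [v0|vn0] := eqVneq (dot v v) 0.
  split; last by rewrite v0 mulr0 dot_ge0.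
  (* Without singular values, [inf] takes its default value 0. *)
  have [S0|] := eqVneq (nz_singular_values A) set0; first by rewrite /sigma_min S0 inf0.
  by move=> /set0P Sn0; apply: lb_le_inf => // s [/ltW].
have unit_sphere (w : 'cV[R]_n) : col_space A^T w -> dot w w != 0 ->
    sphere ((Num.sqrt (dot w w))^-1 *: w).
  move=> wA wn0; split; first exact: col_spaceZ.
  by rewrite !dotE mulrA -invfM -expr2 sqr_sqrtr ?dot_ge0 // mulVf.
have [u] : exists2 u, u \in sphere & forall t, t \in sphere ->
    dot (A *m u) (A *m u) <= dot (A *m t) (A *m t).
  apply: compact_EVT_min; first by eexists; exact: unit_sphere vA vn0.
    exact: row_space_sphere_compact.
  exact/continuous_subspaceT/dot_continuous.
rewrite inE => -[uA u1] umin; set l := dot (A *m u) (A *m u) in umin.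
have lP (w : 'cV[R]_n) : col_space A^T w -> l * dot w w <= dot (A *m w) (A *m w).
  move=> wA; have [->|wn0] := eqVneq (dot w w) 0; first by rewrite mulr0 dot_ge0.
  have := umin _ (mem_set (unit_sphere w wA wn0)).
  rewrite -scalemxAr !dotE mulrA -invfM -expr2 sqr_sqrtr ?dot_ge0 //.
  by rewrite mulrC ler_pdivlMr // lt0r wn0 dot_ge0.
(* [r] is half the gradient at [u] of |A v|^2 - l |v|^2. It lies in R(A^T) itself, so varying [u]
   along [r] is admissible and the linear coefficient is |r|^2. *)
have [r rE] : exists r, r = A^T *m (A *m u) - l *: u by eexists.
have rA : col_space A^T r.
  by rewrite rE; apply: col_spaceD; [exists (A *m u)|rewrite -scaleNr; exact: col_spaceZ].
have r0 : r = 0.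
  apply/eqP; rewrite -dot_eq0; apply/eqP.
  apply: (@quadratic_ge0_linear_eq0 _ (dot (A *m r) (A *m r) - l * dot r r)) => t.
  have := lP (u + t *: r) (col_spaceD uA (col_spaceZ t rA)).
  rewrite mulmxDr -scalemxAr !dotE u1 -/l (dotC r u) (dotC (A *m r) (A *m u)).
  have -> : dot r r = dot (A *m u) (A *m r) - l * dot u r.
    by rewrite {1}rE !dotE dot_trmx_mul.
  by lra.
have l_gt0 : 0 < l.
  rewrite lt0r dot_ge0 andbT dot_eq0; apply/eqP => Au0.
  (* With u = A^T w, one has |u|^2 = <w, A u> = 0, against |u| = 1. *)
  have [w _ wu] := uA; move/eqP: u1; rewrite -{1}wu dot_trmx_mul Au0 /dot big1.
    by rewrite eq_sym oner_eq0.
  by move=> i _; rewrite mxE mulr0.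
have ls : nz_singular_values A (Num.sqrt l).
  split; first by rewrite sqrtr_gt0.
  rewrite sqr_sqrtr ?ltW //; apply/eigenvalueP; exists u^T.
    apply: trmx_inj; rewrite !trmx_mul !trmxK linearZ /= trmxK -mulmxA.
    by apply/eqP; rewrite -subr_eq0 -rE r0.
  by apply: contra_eq_neq u1 => /(congr1 trmx); rewrite trmxK trmx0 => /eqP;
     rewrite -dot_eq0 => /eqP ->; rewrite eq_sym oner_neq0.
have lb0 : lbound (nz_singular_values A) 0 by move=> s [/ltW].
have s0 : 0 <= sigma_min A by apply: lb_le_inf lb0; exists (Num.sqrt l).
split=> //; apply: le_trans (lP _ vA); rewrite ler_wpM2r ?dot_ge0 //.
rewrite -(sqr_sqrtr (ltW l_gt0)) lerXn2r ?nnegrE ?sqrtr_ge0 //.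
by apply: ge_inf ls; exists 0.
Qed.

End SigmaMin.

(** * The momentum estimate and the characteristic root *)

Section ScalarInequalities.
Variable R : realType.

(* The cross term is split as
   2 <t g, e' - e> = - 4 <t g, e> + 2 <t g, e + e'>
                  <= - 4 <t g, e> + |t g|^2 + |e + e'|^2,
   and |e + e'|^2 is absorbed by |e - e'|^2 + |e + e'|^2 = 2 |e|^2 + 2 |e'|^2. *)
Lemma momentum_step (n : nat) (e e' g : 'cV[R]_n) (t S xi omega : R) :
  0 <= omega -> 0 <= t -> (1 - xi) * S <= dot g e -> t * dot g g = S ->
  dot (e - t *: g + omega *: (e - e')) (e - t *: g + omega *: (e - e'))
    <= (1 + 3 * omega + 2 * omega ^+ 2) * dot e e
    + (omega + 2 * omega ^+ 2) * dot e' e'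
    - (1 - 2 * xi + 3 * omega - 4 * omega * xi) * (t * S).
Proof.
move=> w0 t0 ge gg.
(* [h1] collects every occurrence of <t g, e>: weight 2 from |e - t g|^2 and 4 omega from the split
   cross term. [h2] is Young's inequality for that term, and [h3] bounds |e - e'|^2 by 2 |e|^2 + 2
   |e'|^2. *)
have h1 : 0 <= t * (2 + 4 * omega) * (dot g e - (1 - xi) * S).
  by rewrite !mulr_ge0 // ?subr_ge0 //; lra.
have h2 : 0 <= omega * dot (t *: g - (e + e')) (t *: g - (e + e')).
  by rewrite mulr_ge0 ?dot_ge0.
have h3 : 0 <= omega ^+ 2 * dot (e + e') (e + e').
  by rewrite mulr_ge0 ?dot_ge0 ?sqr_ge0.
move: h1 h2 h3; rewrite !dotE (dotC e' e) (dotC e g) (dotC e' g) -gg.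
by nra.
Qed.

(** The bounds on [p] become bounds on the square root [s], obtained by comparing squares; [a1] may
    be negative. *)
Lemma two_term_recursion_root (a1 a2 : R) : 0 <= a2 -> a1 + a2 < 1 ->
  let p := (a1 + Num.sqrt (a1 ^+ 2 + 4 * a2)) / 2 in
  [/\ a1 + a2 <= p, p < 1, a1 <= p, 0 <= p & p * (p - a1) = a2].
Proof.
move=> a20 a12; set s := Num.sqrt _; move=> p.
have d0 : 0 <= a1 ^+ 2 + 4 * a2 by have := sqr_ge0 a1; lra.
have s0 : 0 <= s by exact: sqrtr_ge0.
have s2 : s ^+ 2 = a1 ^+ 2 + 4 * a2 by rewrite sqr_sqrtr.
have pE : 2 * p = a1 + s by rewrite /p; field.
have sa : `|a1| <= s by rewrite -sqrtr_sqr ler_wsqrtr //; lra.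
move: sa; rewrite ler_norml => /andP[sa1 sa2].
have p1 : p < 1.
  suff : s < 2 - a1 by lra.
  by rewrite -(ltr_pXn2r (ltn0Sn 1)) ?nnegrE //; nra.
have ple : a1 + a2 <= p.
  suff : a1 + 2 * a2 <= s by lra.
  have [h|h] := leP 0 (a1 + 2 * a2); last lra.
  by rewrite -(ler_pXn2r (ltn0Sn 1)) ?nnegrE //; nra.
by split=> //; (lra || nra).
Qed.

End ScalarInequalities.

(** * Size and sign of the residual weights *)

Section Weights.
Variables (R : realType) (q : nat).
Hypothesis q2 : (2 <= q)%N.

Lemma normr_weight (a : R) : `|weight q a| = `|a| ^+ q.-1.
Proof.
case: q q2 => [|[|r]] // _; rewrite /weight /=.
by case: ifP => _; rewrite ?normrM ?normr_id !normrX // -exprSr.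
Qed.

(** For either parity of [q] the weight has the sign of its argument, so no cancellation occurs in
    eta^T f_tau. *)
Lemma weight_mulr (a : R) : weight q a * a = `|weight q a| * `|a|.
Proof.
rewrite -normrM ger0_norm // /weight; case: ifPn => [_|qev].
  by rewrite -mulrA mulr_ge0 // -expr2 sqr_ge0.
case: q q2 qev => [//|r] _ /= odd_r; rewrite -exprSr.
by rewrite exprn_even_ge0.
Qed.

End Weights.

(** * Estimates for the update direction *)

Section Direction.
Variables (R : realType) (m n : nat).
Variables (f : 'cV[R]_n -> 'cV[R]_m) (J : 'cV[R]_n -> 'M[R]_(m, n)).
Variables (q : nat) (rho : R) (x : 'cV[R]_n).
Hypotheses (m_gt0 : (0 < m)%N) (q2 : (2 <= q)%N) (rho01 : 0 < rho <= 1).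

Local Notation maxres := (\big[Num.max/0]_j `|f x j 0| ^+ 2).
Local Notation eta := (Defs.eta f q rho x).
Local Notation S := ((eta^T *m f_tau f rho x) 0 0).
Local Notation g := ((J_tau f J rho x)^T *m eta).
Local Notation W := (\sum_i `|eta i 0|).

Lemma eta_mul_f_tauE : S = \sum_i `|eta i 0| * `|f_tau f rho x i 0|.
Proof. by rewrite mxE; apply: eq_bigr => i _; rewrite !mxE weight_mulr. Qed.

Lemma eta_mul_f_tau_ge : Num.sqrt (rho * maxres) * W <= S.
Proof.
rewrite eta_mul_f_tauE mulr_sumr; apply: ler_sum => i _.
rewrite mulrC ler_wpM2l // mxE -[leRHS]normr_id -sqrtr_sqr ler_wsqrtr //.
by have := enum_valP i; rewrite inE.
Qed.

Lemma maxres_gt0 : f x != 0 -> 0 < maxres.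
Proof.
move=> fx0; have /existsP[j fj0] : [exists j, f x j 0 != 0].
  apply: contraNT fx0 => /existsPn fx0; apply/eqP/colP => j.
  by rewrite mxE; apply/eqP; rewrite -[_ == _]negbK.
by apply: lt_le_trans (le_bigmax _ _ j); rewrite exprn_gt0 // normr_gt0.
Qed.

(** As rho <= 1, an index of maximal residual belongs to [tau], and its weight is nonzero. *)
Lemma sum_eta_gt0 : f x != 0 -> 0 < W.
Proof.
move=> fx0; case/andP: rho01 => rho0 rho1; have M0 := maxres_gt0 fx0.
have [i _ Mi] : {i | i \in 'I_m & maxres = `|f x i 0| ^+ 2}.
  by apply: (@eq_bigmax _ _ _ _ (Ordinal m_gt0)) => // i _; exact: exprn_ge0.
have itau : i \in tau f rho x by rewrite inE -Mi ler_piMl // ltW.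
rewrite (bigD1 (enum_rank_in itau i)) //= ltr_wpDr ?sumr_ge0 //.
rewrite !mxE enum_rankK_in // normr_weight // exprn_gt0 //.
by rewrite lt0r normr_ge0 andbT; apply: contraTneq M0 => fi0; rewrite Mi fi0 expr0n ltxx.
Qed.

Lemma eta_mul_f_tau_gt0 : f x != 0 -> 0 < S.
Proof.
move=> fx0; apply: lt_le_trans eta_mul_f_tau_ge.
by rewrite mulr_gt0 ?sum_eta_gt0 // sqrtr_gt0 mulr_gt0 ?maxres_gt0 //; case/andP: rho01.
Qed.

(** Each row's cone inequality is multiplied by |eta_i|, and the results are summed. *)
Lemma direction_dot_ge (e : 'cV[R]_n) (xi : R) :
  (forall i, `|f x i 0 - (row i (J x) *m e) 0 0| <= xi * `|f x i 0|) ->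
  (1 - xi) * S <= dot g e.
Proof.
move=> cone; rewrite dot_trmx_mul eta_mul_f_tauE mulr_sumr.
apply: ler_sum => i _; set j := enum_val i.
have -> : (J_tau f J rho x *m e) i 0 = (row j (J x) *m e) 0 0.
  by rewrite !mxE; apply: eq_bigr => k _; rewrite !mxE.
have := cone j; set d := (_ *m e) 0 0; rewrite !mxE -/j => cj.
have : `|weight q (f x j 0)| * `|f x j 0 - d|
    <= `|weight q (f x j 0)| * (xi * `|f x j 0|) by rewrite ler_wpM2l.
rewrite -normrM => /(le_trans (ler_norm _)).
by rewrite mulrBr weight_mulr //; lra.
Qed.

Lemma direction_sqr_le (alpha : R) :
  (forall i, enorm (row i (J x)) ^+ 2 <= alpha) -> dot g g <= alpha * W ^+ 2.
Proof.
move=> Ja; apply: dot_trmx_mul_le => i; apply: le_trans (Ja (enum_val i)).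
by rewrite enorm_row_sqr row_rowsub.
Qed.

(** A zero direction would force (1 - xi) S <= 0; hence the step size never divides by 0. *)
Lemma direction_sqr_gt0 (e : 'cV[R]_n) (xi : R) : xi < 1 -> f x != 0 ->
  (1 - xi) * S <= dot g e -> 0 < dot g g.
Proof.
move=> xi1 fx0 ge; rewrite lt0r dot_ge0 andbT dot_eq0.
apply: contraTneq ge => ->; rewrite -ltNge /dot big1 => [|i _].
  by rewrite mulr_gt0 ?eta_mul_f_tau_gt0 // subr_gt0.
by rewrite mxE mul0r.
Qed.

Lemma residual_gain (A : 'M[R]_(m, n)) (e : 'cV[R]_n) (xi alpha : R) :
  0 <= xi -> f x != 0 -> 0 < dot g g ->
  (forall i, `|f x i 0 - (row i A *m e) 0 0| <= xi * `|f x i 0|) ->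
  (forall i, enorm (row i (J x)) ^+ 2 <= alpha) ->
  col_space A^T e ->
  m%:R ^ (1 - q%:Z) * rho * sigma_min A ^+ 2 / (alpha * (1 + xi) ^+ 2) * dot e e
    <= S / dot g g * S.
Proof.
move=> xi0 fx0 g0 cone Ja eA; have [rho0 _] := andP rho01.
have [s0 sE] := sigma_min_bound eA.
have M0 := maxres_gt0 fx0; have W0 := sum_eta_gt0 fx0.
have rM0 : 0 <= rho * maxres by rewrite mulr_ge0 ?(ltW rho0) ?(ltW M0).
have ga := direction_sqr_le Ja.
have W20 : 0 < W ^+ 2 by rewrite exprn_gt0.
(* Positivity of [alpha] follows from 0 < |g|^2 <= alpha W^2. *)
have a0 : 0 < alpha by rewrite -(pmulr_lgt0 _ W20) (lt_le_trans g0).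
have Ae : dot (A *m e) (A *m e) <= (1 + xi) ^+ 2 * (m%:R * maxres).
  rewrite /dot -[m in m%:R]card_ord -sum1_card natr_sum mulr_suml mulr_sumr.
  apply: ler_sum => i _; rewrite mul1r -expr2.
  have := cone i; have -> : (row i A *m e) 0 0 = (A *m e) i 0.
    by rewrite -row_mul mxE.
  set a := (A *m e) i 0 => ci.
  apply: le_trans (_ : (1 + xi) ^+ 2 * `|f x i 0| ^+ 2 <= _); last first.
    by rewrite ler_wpM2l ?sqr_ge0 //; exact: (le_bigmax _ (fun j => `|f x j 0| ^+ 2)).
  rewrite -exprMn -real_normK ?num_real // lerXn2r ?nnegrE //.
    by rewrite mulr_ge0 //; lra.
  have := ler_normB (f x i 0) (f x i 0 - a); rewrite subKr; lra.
(* As q >= 2, m^(1-q) is at most 1/m, which absorbs the factor [m] in [Ae]. *)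
have mq : (m%:R : R) ^ (1 - q%:Z) * m%:R <= 1.
  have m1 : (1 : R) <= m%:R by rewrite ler1n.
  have -> : 1 - q%:Z = - (q.-1)%:Z
    by case: q q2 => // r _; rewrite intS opprD addrA subrr add0r.
  rewrite -exprnN; case: q q2 => [|[|r]] // _ /=.
  rewrite mulrC ler_pdivrMr ?exprn_gt0 ?ltr0n // mul1r.
  by apply: ler_eXnr.
have S2 : rho * maxres * W ^+ 2 <= S ^+ 2.
  rewrite -[rho * _]sqr_sqrtr // -exprMn.
  rewrite lerXn2r ?nnegrE ?mulr_ge0 ?sqrtr_ge0 ?(ltW W0) //.
    exact/ltW/eta_mul_f_tau_gt0.
  exact: eta_mul_f_tau_ge.
(* The intermediate value separates the bound on [e] from the bounds on S and |g|. *)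
apply: (@le_trans _ _ (rho * maxres / alpha)).
  have x20 : 0 < (1 + xi) ^+ 2 by rewrite exprn_gt0 //; lra.
  have -> : m%:R ^ (1 - q%:Z) * rho * sigma_min A ^+ 2
      / (alpha * (1 + xi) ^+ 2) * dot e e
    = m%:R ^ (1 - q%:Z) * rho / (1 + xi) ^+ 2 * (sigma_min A ^+ 2 * dot e e)
      / alpha.
    by field; rewrite !gt_eqF //; lra.
  rewrite ler_pM2r ?invr_gt0 //.
  apply: (@le_trans _ _ (m%:R ^ (1 - q%:Z) * rho / (1 + xi) ^+ 2
      * ((1 + xi) ^+ 2 * (m%:R * maxres)))).
    apply: ler_wpM2l; last exact: le_trans sE Ae.
    by rewrite !mulr_ge0 ?invr_ge0 ?exprz_ge0 ?(ltW rho0) ?(ltW x20).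
  have -> : m%:R ^ (1 - q%:Z) * rho / (1 + xi) ^+ 2
      * ((1 + xi) ^+ 2 * (m%:R * maxres))
    = m%:R ^ (1 - q%:Z) * m%:R * (rho * maxres).
    by field; rewrite gt_eqF //; lra.
  by rewrite ler_piMl.
rewrite [leRHS]mulrAC -expr2 ler_pdivlMr // mulrAC ler_pdivrMr //.
apply: le_trans (_ : rho * maxres * (alpha * W ^+ 2) <= _).
  by rewrite ler_wpM2l.
by rewrite mulrCA mulrC ler_wpM2r // ltW.
Qed.

End Direction.

(** The recursion is assumed only up to [K], because iterates beyond the stopping index are
    unconstrained. The factor 1 + (p - a1) comes from F 1 = F 0. *)
Lemma two_term_recursion_bound (R : realType) (a1 a2 p : R) (F : nat -> R) K :
  0 <= p -> a1 <= p -> p * (p - a1) = a2 -> (forall k, 0 <= F k) ->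
  F 1%N = F 0%N ->
  (forall k, (1 <= k <= K)%N -> F k.+1 <= a1 * F k + a2 * F k.-1) ->
  F K.+1 <= p ^+ K * (1 + (p - a1)) * F 0%N.
Proof.
move=> p0 pa pE F0 F1 rec.
suff : F K.+1 + (p - a1) * F K <= p ^+ K * (1 + (p - a1)) * F 0%N.
  by apply: le_trans; rewrite lerDl mulr_ge0 ?subr_ge0.
elim: K rec => [|K IH] rec; first by rewrite F1 expr0; lra.
have /IH : forall k, (1 <= k <= K)%N -> F k.+1 <= a1 * F k + a2 * F k.-1.
  by move=> k /andP[k1 kK]; apply: rec; rewrite k1 leqW.
move=> /(ler_wpM2l p0); rewrite exprS.
have := rec K.+1; rewrite ltnS leqnn /= -pE => /(_ isT); lra.
Qed.

Theorem theorem3p2 (R : realType) (m n : nat) (D : set 'cV[R]_n)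
    (f : 'cV[R]_n -> 'cV[R]_m) (J : 'cV[R]_n -> 'M[R]_(m, n))
    (xi_ : 'I_m -> R) (x0 xdag : 'cV[R]_n)
    (q : nat) (omega rho : R) (x : nat -> 'cV[R]_n) :
  (0 < m)%N ->
  bounded_set D -> closed D ->
  derivative_on D f J -> {within D, continuous J} ->
  (forall i, 0 <= xi_ i) ->
  let xi := \big[Num.max/0]_i xi_ i in
  xi <= 2^-1 ->
  tangential_cone D f J xi_ ->
  D xdag -> f xdag = 0 ->
  (forall z, D z -> null_space (J xdag) `<=` null_space (J z)) ->
  D x0 ->
  (forall z, D z -> f z = 0 -> enorm (xdag - x0) <= enorm (z - x0)) ->
  col_space (J xdag)^T (xdag - x0) ->
  (2 <= q)%N -> 0 <= omega < 1 -> 0 < rho <= 1 ->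
  let alpha :=
    \big[Num.max/0]_(i < m) sup [set enorm (row i (J z)) ^+ 2 | z in D] in
  let a1 := 1 + 3 * omega + 2 * omega ^+ 2
    - (1 - 2 * xi + 3 * omega - 4 * omega * xi)
      * (m%:R ^ (1 - q%:Z) * rho * sigma_min (J xdag) ^+ 2
         / (alpha * (1 + xi) ^+ 2)) in
  let a2 := omega + 2 * omega ^+ 2 in
  a1 + a2 < 1 ->
  MRWNKm_sequence f J q omega rho x0 x ->
  (forall k, generated f x k -> D (x k)) ->
  let p2 := (a1 + Num.sqrt (a1 ^+ 2 + 4 * a2)) / 2 in
  let b2 := p2 - a1 in
  a1 + a2 <= p2 < 1 /\
  forall k, (1 <= k)%N -> generated f x k.+1 ->
    enorm (x k.+1 - xdag) ^+ 2
      <= p2 ^+ k * (1 + b2) * enorm (x0 - xdag) ^+ 2.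
Proof.
move=> m0 Db Dc _ Jc xi_0 xi xi2 cone Dd fd nullD Dx0 _ x0d q2 w01 r01 alpha a1 a2.
move=> a12 [xi0E x1E step] Dx p2 b2.
have /andP[w0 w1] := w01.
have a20 : 0 <= a2 by rewrite addr_ge0 // mulr_ge0 ?sqr_ge0.
have [p2ge p2lt p2a1 p20 p2E] := two_term_recursion_root a20 a12.
split=> [|k k1 gk]; first by rewrite p2ge.
have Dcpt := cV_bounded_closed_compact Db Dc.
have xi0 : 0 <= xi by apply: bigmax_ge_id.
have xi_le i : xi_ i <= xi by exact: le_bigmax.
have Ja z i : D z -> enorm (row i (J z)) ^+ 2 <= alpha.
  move=> Dz; apply: le_trans (le_bigmax _ _ i).
  by apply: (ub_le_sup (row_norm_has_ubound _ Dcpt Jc)); exists z.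
have coneE y z i : D y -> D z ->
    `|f y i 0 - f z i 0 - (row i (J y) *m (y - z)) 0 0| <= xi * `|f y i 0 - f z i 0|.
  by move=> Dy Dz; apply: le_trans (cone y z Dy Dz i) _; rewrite ler_wpM2r.
have gen_le i j : (i <= j)%N -> generated f x j -> generated f x i.
  by move=> ij gj l /andP[l1 li]; apply: gj; rewrite l1 (leq_trans li).
pose e j := x j - xdag.
have stepE j : (1 <= j)%N -> generated f x j.+1 ->
    let g := (J_tau f J rho (x j))^T *m Defs.eta f q rho (x j) in
    e j.+1 = e j - (((Defs.eta f q rho (x j))^T *m f_tau f rho (x j)) 0 0 / dot g g) *: g
      + omega *: (e j - e j.-1).
  move=> j1 gj /=; rewrite /e step // /MRWNKm_step enorm_sqr.
  set d := _ *: (_ *m _).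
  have -> : x j - xdag - (x j.-1 - xdag) = x j - x j.-1.
    by rewrite opprB addrA subrK.
  by rewrite [LHS]addrAC (addrAC (x j)).
(* The momentum term reaches back two iterates, hence strong induction with two base cases. *)
have col_e j : generated f x j -> col_space (J xdag)^T (e j).
  elim/ltn_ind: j => -[|[|j]] IH gj.
  - by rewrite /e xi0E -opprB; exact: col_spaceN.
  - by rewrite /e x1E -opprB; exact: col_spaceN.
  have gj1 : generated f x j.+1 by apply: gen_le gj.
  have gj0 : generated f x j by apply: gen_le gj1.
  rewrite stepE //=; apply: col_spaceD; last first.
    by apply/col_spaceZ/col_spaceD; [exact: IH|exact/col_spaceN/IH].
  apply: col_spaceD; first exact: IH.
  apply/col_spaceN/col_spaceZ; rewrite /J_tau.
  (* The null space condition gives J(x_j) = B J(xdag), so the direction lies in R(J(xdag)^T). *)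
  have /submxP[B ->] := null_space_submx (nullD _ (Dx _ gj1)).
  rewrite -mul_rowsub_mx trmx_mul -mulmxA.
  by exists ((rowsub enum_val B)^T *m Defs.eta f q rho (x j.+1)).
pose F j := dot (e j) (e j).
rewrite enorm_sqr -[x0]xi0E enorm_sqr -/(F k.+1) -/(F 0%N).
apply: two_term_recursion_bound p20 p2a1 p2E _ _ _ => [j||j /andP[j1 jk]].
- exact: dot_ge0.
- by rewrite /F /e x1E xi0E.
have gj : generated f x j.+1 by apply: gen_le gk.
have gj0 : generated f x j by apply: gen_le gj.
have Dj := Dx _ gj0.
have fj : f (x j) != 0 by apply/eqP; apply: gk; rewrite j1.
rewrite /F stepE //.
set g := (J_tau _ _ _ _)^T *m _; set S := (_^T *m f_tau _ _ _) 0 0.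
have ge : (1 - xi) * S <= dot g (e j).
  apply: direction_dot_ge => // i; have := coneE (x j) xdag i Dj Dd.
  have -> : f xdag i 0 = 0 by rewrite fd mxE.
  by rewrite subr0.
have gg : 0 < dot g g by apply: direction_sqr_gt0 ge => //; lra.
have S0 : 0 < S by exact: eta_mul_f_tau_gt0.
have tgg : S / dot g g * dot g g = S by rewrite divfK // gt_eqF.
have t0 : 0 <= S / dot g g by rewrite divr_ge0 ?ltW.
apply: le_trans (momentum_step _ w0 t0 ge tgg) _.
have gain : m%:R ^ (1 - q%:Z) * rho * sigma_min (J xdag) ^+ 2
    / (alpha * (1 + xi) ^+ 2) * F j <= S / dot g g * S.
  apply: residual_gain => // [i|i|]; last exact: col_e.
    (* The cone condition is now based at [xdag], where [sigma_min] is taken; for [ge] it was based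
       at x_j. *)
    have := coneE xdag (x j) i Dd Dj.
    have -> : (row i (J xdag) *m (xdag - x j)) 0 0
        = - (row i (J xdag) *m e j) 0 0.
      by rewrite -[xdag - _]opprB mulmxN mxE.
    have -> : f xdag i 0 = 0 by rewrite fd mxE.
    by rewrite sub0r opprK normrN addrC distrC.
  exact: Ja.
(* From xi <= 1/2, both 1 - 2 xi and 3 - 4 xi are nonnegative, so [gain] may be scaled by this
   coefficient. *)
have c0 : 0 <= 1 - 2 * xi + 3 * omega - 4 * omega * xi.
  have : 0 <= omega * (3 - 4 * xi) by rewrite mulr_ge0 //; lra.
  lra.
have := ler_wpM2l c0 gain.
rewrite -/(F j) -/(F j.-1) -/a2 /a1.
set kappa := _ / _; lra.
Qed.
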